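(* Let $(\mathcal{S}^x,H)$ be a finite skew translation generalized quadrangle of order $(q,q)$, $q$ an odd power of the prime $p$ (i.e. $q$ odd), let $\mathbb{S}$ be its group of symmetries about $x$, and let $(\mathcal{F},\mathcal{F}^* )$ be the associated Kantor family (with respect to any point not collinear with $x$). The following are equivalent: (i) the members of $\mathcal{F}^*$ are abelian; (ii) $\mathcal{S}$ satisfies $(M)_x$; (iii) $H$ is a special group of exponent $p$; (iv) $\mathbb{S}\le Z(H)$; (v) $\mathbb{S}=Z(H)$.
   Context: A finite generalized quadrangle (GQ) of order $(s,t)$: every line has $s+1$ points, every point is on $t+1$ lines, two points are on at most one common line, and for each point $p$ not on a line $L$ there is a unique point of $L$ collinear with $p$, denoted $\mathrm{proj}_Lp$. An elation generalized quadrangle $(\mathcal{S}^x,H)$: $H\le\mathrm{Aut}(\mathcal{S})$ fixes every line through $x$ and acts sharply transitively on the points not collinear with $x$. A symmetry about $x$ is an automorphism fixing every point collinear with $x$; the EGQ is a skew translation generalized quadrangle if $H$ contains a subgroup $\mathbb{S}$ of order $t$ of symmetries about $x$. Kantor family: for a point $z$ not collinear with $x$ with lines $U_0,\dots,U_t$ through it and $u_i=\mathrm{proj}_{U_i}x$, put $\mathcal{F}=\{H_{U_i}\}$ and $\mathcal{F}^*=\{H_{u_i}\}$ (stabilizers). Condition $(M)_x$: for every line $L$ through $x$, every point $y\neq x$ on $L$, and every line $M\neq L$ through $y$, the group of automorphisms of $\mathcal{S}$ fixing every line through $x$, every line through $y$ and every point of $L$ acts transitively on the points of $M$ different from $y$.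 A finite $p$-group $H$ is special if $Z(H)=[H,H]=\Phi(H)$ is elementary abelian ($\Phi$ the Frattini subgroup). *)

(* Defs.v *)
From mathcomp Require Import all_boot all_fingroup all_solvable.
Set Implicit Arguments. Unset Strict Implicit. Unset Printing Implicit Defensive.

(* A finite incidence geometry is modelled by a finite type of points [P] and a
   set [Lines] of lines, each line being identified with its set of points
   (legitimate for generalized quadrangles, where two distinct lines share at
   most one point and each line has s+1 >= 2 points). *)

Section GQ.
Variable P : finType.
Variable Lines : {set {set P}}.

(* two points are collinear if some line contains both (so x ~ x) *)
Definition collinear (y z : P) : bool :=
  [exists l in Lines, (y \in l) && (z \in l)].

Definition is_GQ (s t : nat) : Prop :=
  [/\ (forall l, l \in Lines -> #|l| = s.+1),
      (forall y : P, #|[set l in Lines | y \in l]| = t.+1),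
      (forall y z l1 l2, y != z -> l1 \in Lines -> l2 \in Lines ->
          y \in l1 -> z \in l1 -> y \in l2 -> z \in l2 -> l1 = l2) &
      (forall y l, l \in Lines -> y \notin l ->
          exists! w, w \in l /\ collinear y w)].

Definition Aut : {set {perm P}} :=
  [set g : {perm P} | [forall l in Lines, (g @: l) \in Lines]].

Definition opp_pts (x : P) : {set P} := [set y | ~~ collinear x y].

Definition is_EGQ (x : P) (H : {set {perm P}}) : Prop :=
  [/\ H \subset Aut,
      (forall h l, h \in H -> l \in Lines -> x \in l -> h @: l = l) &
      (forall y z, y \in opp_pts x -> z \in opp_pts x ->
          exists! h, h \in H /\ h y = z)].

Definition is_symmetry (x : P) (g : {perm P}) : bool :=
  (g \in Aut) && [forall y, collinear x y ==> (g y == y)].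

Definition condM (x : P) : Prop :=
  forall L y M, L \in Lines -> x \in L -> y \in L -> y != x ->
    M \in Lines -> y \in M -> M != L ->
    let G := [set g in Aut |
               [forall l in Lines, (x \in l) ==> (g @: l == l)] &&
               [forall l in Lines, (y \in l) ==> (g @: l == l)] &&
               [forall w in L, g w == w]] in
    forall a b, a \in M -> a != y -> b \in M -> b != y ->
      exists2 g, g \in G & g a = b.

End GQ.

Local Open Scope group_scope.
Definition special_pgroup (gT : finGroupType) (p : nat) (H : {group gT}) : Prop :=
  [/\ p.-group H, special H & p.-abelem 'Z(H)].

(* Main.v *)
Require Import Defs.
From mathcomp Require Import all_boot all_fingroup all_solvable.
From mathcomp Require Import zify.

(** With [A i] and [As i] the stabilizers in [H] of the lines [U_i] on [z] and of
    their points [u_i] collinear with [x], one has [As i = A i * S], the quotient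
    [H / S] is elementary abelian because the [As i / S] form a spread, and [H] is
    the disjoint union of [As i] and the sets [A i * A j :\: A i], [j != i].  Two
    parity arguments, each pairing off the [q] indices different from a given [i]
    without fixed point, use that [q] is odd: the first shows ['Phi(H) = S], the
    second that a central element of [As i] lies in [A i] or in [S].  Condition
    [(M)_x] forces [A i] to fix every line on [u_i]: an automorphism fixing all
    lines on [x], all points of one of them and a point not collinear with [x]
    is rigid enough to identify the elements [(M)_x] provides with those of [A i].
    Then [S] normalises, hence centralises, every [A i]. *)

Set Implicit Arguments. Unset Strict Implicit. Unset Printing Implicit Defensive.
Local Open Scope group_scope.

(** * Finite counting *)

Lemma perfect_matching_even (T : finType) (J : {set T}) (R : rel T) :
    symmetric R -> irreflexive R ->
    (forall j, j \in J -> exists! k, k \in J /\ R j k) ->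
  ~~ odd #|J|.
Proof.
move=> symR irrR; have [m] := ubnP #|J|.
elim: m J => // m IHm J leJm matchJ.
have [->|[j Jj]] := set_0Vmem J; first by rewrite cards0.
have [k [[Jk Rjk] _]] := matchJ j Jj.
have neq_kj : k != j by apply: contraL Rjk => /eqP ->; rewrite irrR.
have Jjk : k \in J :\ j by rewrite !inE neq_kj.
have cardJ : #|J| = #|J :\ j :\ k|.+2.
  by rewrite (cardsD1 j J) Jj (cardsD1 k (J :\ j)) Jjk.
rewrite cardJ /= negbK; apply: IHm => [|i]; first by rewrite cardJ in leJm; lia.
rewrite !inE => /and3P[neq_ik neq_ij Ji].
have [l [[Jl Ril] Ul]] := matchJ i Ji.
exists l; split=> [|l' [/[!inE]/and3P[_ _ Jl'] Ril']]; last exact: Ul.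
(* The partner [l] of [i] survives the removal of [j] and [k]: otherwise uniqueness of partners
   would identify [i] with [j] or [k]. *)
rewrite !inE Jl Ril andbT; split=> //; apply/andP; split; apply/eqP => El.
- have [i' [_ Ui']] := matchJ k Jk.
  have Ei : i' = i by apply: Ui'; rewrite Ji symR -El.
  have Ej : i' = j by apply: Ui'; rewrite Jj symR.
  by rewrite -Ei Ej eqxx in neq_ij.
- have [i' [_ Ui']] := matchJ j Jj.
  have Ei : i' = i by apply: Ui'; rewrite Ji symR -El.
  have Ej : i' = k by apply: Ui'.
  by rewrite -Ei Ej eqxx in neq_ik.
Qed.

Lemma card_bigcup_disjoint (T I : finType) (F : I -> {set T}) :
    (forall i j, i != j -> [disjoint F i & F j]) ->
  #|\bigcup_i F i| = (\sum_i #|F i|)%N.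
Proof.
move=> disjF; rewrite -sum1_card partition_disjoint_bigcup //.
by apply: eq_bigr => i _; rewrite sum1_card.
Qed.

Lemma exists_neq (I : finType) (i : I) : 1 < #|I| -> exists j, j != i.
Proof.
move=> I_gt1; have /card_gt0P[j] : 0 < #|predC1 i|.
  by rewrite cardC1 -ltnS prednK // ltnW.
by rewrite inE; exists j.
Qed.

(** * Spreads: q + 1 subgroups of order q in a group of order q^2 *)

Section Spread.

Variables (gT : finGroupType) (I : finType) (p n q : nat).
Variables (G : {group gT}) (A : I -> {group gT}).
Hypotheses (p_pr : prime p) (n_gt0 : 0 < n) (defq : q = (p ^ n)%N).
Hypotheses (cardI : #|I| = q.+1) (cardG : #|G| = (q * q)%N).
Hypotheses (cardA : forall i, #|A i| = q) (sAG : forall i, A i \subset G).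
Hypothesis tiA : forall i j, i != j -> A i :&: A j = 1.

Let q_gt0 : 0 < q.
Proof. by rewrite defq expn_gt0 prime_gt0. Qed.

Let I_gt1 : 1 < #|I|.
Proof. by rewrite cardI ltnS. Qed.

(** The sets [(A i)^#] are disjoint and have (q + 1)(q - 1) = q^2 - 1 elements in all, as many as
    [G^#]. *)
Lemma spread_cover g : g \in G -> exists i, g \in A i.
Proof.
have disjA i j : i != j -> [disjoint (A i)^# & (A j)^#].
  move=> neq_ij; rewrite -setI_eq0 -setDIl (tiA neq_ij); by rewrite setDv.
have cardU : #|\bigcup_i (A i)^#| = (q.+1 * q.-1)%N.
  rewrite (card_bigcup_disjoint disjA).
  transitivity (\sum_(i : I) q.-1)%N.
    apply: eq_bigr => i _.
    by rewrite -(cardA i) (cardsD1 1 (A i)) group1.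
  by rewrite sum_nat_const cardI.
have defG : \bigcup_i (A i)^# = G^#.
  apply/eqP; rewrite eqEcard cardU; apply/andP; split.
    by apply/bigcupsP=> i _; apply: setSD; apply: sAG.
  rewrite -ltnS -[#|G^#|.+1]add1n -[1%N]/(true : nat) -(group1 G) -cardsD1 cardG.
  by case: (q) q_gt0 => // r _; nia.
move=> Gg; have [->|ntg] := eqVneq g 1.
  have /card_gt0P[i _] : 0 < #|I| by rewrite cardI.
  by exists i; apply: group1.
have : g \in G^# by rewrite !inE ntg.
by rewrite -defG => /bigcupP[i _ /setD1P[_ Ag]]; exists i.
Qed.

(* A conjugate of A i misses every other A j, because G = A i * A j. *)
Lemma spread_normal i : A i <| G.
Proof.
rewrite /normal sAG; apply/subsetP=> g Gg; rewrite inE.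
apply/subsetP=> h Aigh; have Gh : h \in G.
  by rewrite -(conjGid Gg); apply: subsetP Aigh; rewrite conjSg.
have [j Ajh] := spread_cover Gh.
have [<-//|neq_ij] := eqVneq j i; rewrite eq_sym in neq_ij.
have defG : A i * A j = G.
  apply/eqP; rewrite eqEcard mul_subG //= TI_cardMg ?tiA // !cardA cardG.
  by rewrite leqnn.
have [a b Aia Ajb Eg] : imset2_spec mulg (mem (A i)) (fun=> mem (A j)) g.
  by apply/imset2P; move: Gg; rewrite -defG.
suff: h \in (A i :&: A j) :^ b by rewrite tiA // conjs1g => /set1P ->.
by rewrite conjIg inE (conjGid Ajb) Ajh andbT -(conjGid Aia) -conjsgM -Eg.
Qed.

Lemma spread_commute i j a b :
  i != j -> a \in A i -> b \in A j -> commute a b.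
Proof.
move=> neq_ij Aia Ajb; apply: (centsP _ a Aia b Ajb).
apply/commG1P/trivgP; rewrite /= -(tiA neq_ij) subsetI commg_subl commg_subr.
by rewrite !(subset_trans (sAG _)) ?normal_norm ?spread_normal.
Qed.

Lemma spread_torsion i : exists2 b, b \in A i & b != 1 /\ b ^+ p = 1.
Proof.
have p_A : p %| #|A i| by rewrite cardA defq dvdn_exp.
have [b Ab ob] := Cauchy p_pr p_A; exists b; rewrite // -ob expg_order.
by split=> //; rewrite -order_gt1 ob prime_gt1.
Qed.

Lemma spread_mulP i j a b :
    i != j -> a \in A i -> b \in A j -> b != 1 ->
  exists2 k, k != i & a * b \in A k.
Proof.
move=> neq_ij Aia Ajb ntb.
have Gab : a * b \in G.
  by rewrite groupM ?(subsetP (sAG i) a) ?(subsetP (sAG j) b).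
have [k Akab] := spread_cover Gab; exists k => //.
apply: contraNneq ntb => Ek; rewrite Ek groupMl // in Akab.
by rewrite -in_set1 -[[set 1]](tiA neq_ij) inE Akab.
Qed.

Lemma spread_abelem : p.-abelem G.
Proof.
apply/(abelemP p_pr); split.
  apply/centsP=> c Gc d Gd.
  have [i Aic] := spread_cover Gc; have [j Ajd] := spread_cover Gd.
  have [Ej|neq_ij] := eqVneq i j; last exact: spread_commute neq_ij Aic Ajd.
  (* Write [d] as [(d * b) * b^-1] with [b] in another component: both factors then lie in
     components other than that of [c]. *)
  rewrite -{}Ej in Ajd; have [k neq_ki] := exists_neq i I_gt1.
  have [b Akb [ntb _]] := spread_torsion k; rewrite eq_sym in neq_ki.
  have [l neq_li Aldb] := spread_mulP neq_ki Ajd Akb ntb.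
  rewrite eq_sym in neq_li; rewrite -(mulgK b d).
  apply: commuteM; first exact: spread_commute neq_li Aic Aldb.
  by apply: commuteV; apply: spread_commute neq_ki Aic Akb.
move=> g Gg; have [i Aig] := spread_cover Gg.
have [j neq_ji] := exists_neq i I_gt1; have [b Ajb [ntb bp1]] := spread_torsion j.
rewrite eq_sym in neq_ji; have [k neq_ki Akgb] := spread_mulP neq_ji Aig Ajb ntb.
(* [(g * b) ^+ p] equals [g ^+ p], which thus lies in both [A k] and [A i]. *)
apply/set1P; rewrite -[[set 1]](tiA neq_ki) inE (groupX p Aig) andbT.
have := groupX p Akgb.
by rewrite (expgMn _ (spread_commute neq_ji Aig Ajb)) bp1 mulg1.
Qed.

End Spread.

(** Dividing by [q] and cancelling [q * r.-1] leaves q - r = m(q - r), where q - r is positive. For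
    a maximal subgroup [K], [r] will be the order of [K :&: S]. *)
Lemma members_equation q r m :
    0 < r -> r < q ->
  (r * q * q - q * r = q * (q * r.-1 + m * (q - r)))%N -> m = 1%N.
Proof.
case: r => // r _ lt_rq; have [d defq] : exists d, q = (r.+1 + d.+1)%N.
  by exists (q - r.+2)%N; lia.
have -> : (r.+1 * q * q - q * r.+1 = q * (r.+1 * q - r.+1))%N by rewrite mulnBr; lia.
move/eqP; rewrite eqn_pmul2l; last by lia.
have -> : (q - r.+1 = d.+1)%N by lia.
have -> : (r.+1 * q - r.+1 = q * r + d.+1)%N by rewrite mulSn [(r * q)%N]mulnC; lia.
rewrite /= eqn_add2l -{1}[d.+1]mul1n eqn_pmul2r // => /eqP ->.
by [].
Qed.

(** * Abstract Kantor families with a normal subgroup [S] shared by all [As i] *)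

Section SkewKantorFamily.

Variables (gT : finGroupType) (I : finType) (p n q : nat).
Variables (H S : {group gT}) (A As : I -> {group gT}).
Hypotheses (p_pr : prime p) (p_odd : odd p) (n_gt0 : 0 < n).
Hypotheses (defq : q = (p ^ n)%N) (cardI : #|I| = q.+1).
Hypotheses (cardA : forall i, #|A i| = q) (cardS : #|S| = q).
Hypotheses (sSH : S \subset H) (nSH : H \subset 'N(S)).
Hypothesis defAs : forall i, A i * S = As i.
Hypothesis defH : forall i j, i != j -> As i * A j = H.
Hypothesis tiAsA : forall i j, i != j -> As i :&: A j = 1.
Hypothesis tiAAA : forall i j k a b,
  i != j -> j != k -> i != k ->
  a \in A i -> b \in A j -> a * b \in A k -> a * b = 1.

Lemma q_gt2 : 2 < q.
Proof.
have p_gt2 : 2 < p by apply: odd_prime_gt2.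
by rewrite defq; apply: leq_trans p_gt2 _; rewrite -{1}[p]expn1 leq_pexp2l // prime_gt0.
Qed.

Lemma Kantor_other (i : I) : exists j, j != i.
Proof. by apply: exists_neq; rewrite cardI ltnS (ltn_trans _ q_gt2). Qed.

Lemma sAAs i : A i \subset As i.
Proof. by rewrite -defAs mulG_subl. Qed.

Lemma sSAs i : S \subset As i.
Proof. by rewrite -defAs mulG_subr. Qed.

Lemma sAsH i : As i \subset H.
Proof. by have [j /[1!eq_sym] /defH <-] := Kantor_other i; apply: mulG_subl. Qed.

Lemma sAH i : A i \subset H.
Proof. exact: subset_trans (sAAs i) (sAsH i). Qed.

Lemma tiAS i : A i :&: S = 1.
Proof.
have [j neq_ji] := Kantor_other i; apply/trivgP.
by rewrite /= -(tiAsA neq_ji) setIC setSI ?sSAs.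
Qed.

Lemma tiAA i j : i != j -> A i :&: A j = 1.
Proof.
by move=> neq_ij; apply/trivgP; rewrite /= -(tiAsA neq_ij) setSI ?sAAs.
Qed.

Lemma AsI i j : i != j -> As i :&: As j = S.
Proof.
move=> neq_ij; apply/eqP; rewrite eqEsubset subsetI !sSAs /= andbT.
apply/subsetP=> g /setIP[Asi]; rewrite -defAs => /mulsgP[a s Aa Ss Eg].
suff: a \in As i :&: A j by rewrite tiAsA // => /set1P a1; rewrite Eg a1 mul1g.
by rewrite inE Aa andbT -(groupMr _ (subsetP (sSAs i) _ Ss)) -Eg.
Qed.

Lemma card_As i : #|As i| = (q * q)%N.
Proof. by rewrite -defAs TI_cardMg ?tiAS // cardA cardS. Qed.

Lemma card_H : #|H| = (q * q * q)%N.
Proof.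
have /card_gt0P[i _] : 0 < #|I| by rewrite cardI.
have [j neq_ji] := Kantor_other i.
by rewrite -(defH neq_ji) TI_cardMg ?tiAsA // card_As cardA.
Qed.

Lemma pgroup_H : p.-group H.
Proof. by rewrite /pgroup card_H defq -!expnD pnatX pnat_id. Qed.

Lemma normal_SAs i : S <| As i.
Proof. by rewrite /normal sSAs (subset_trans (sAsH i)). Qed.

Lemma spread_quotient :
  [/\ #|H / S| = (q * q)%N, forall i, #|As i / S| = q,
      forall i, As i / S \subset H / S &
      forall i j, i != j -> (As i / S) :&: (As j / S) = 1].
Proof.
have q_gt0 := ltnW (ltnW q_gt2).
split=> [|i|i|i j neq_ij].
- by rewrite card_quotient // -divgS // card_H cardS mulnK.
- rewrite card_quotient ?normal_norm ?normal_SAs // -divgS ?sSAs //.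
  by rewrite card_As cardS mulnK.
- by rewrite quotientS ?sAsH.
by rewrite -quotientIG ?sSAs // AsI // trivg_quotient.
Qed.

Lemma Kantor_cover g : g \in H -> exists i, g \in As i.
Proof.
move=> Hg; have [cHS cAsS sAsHS tiAsS] := spread_quotient.
have HSg : coset S g \in H / S by apply: mem_quotient.
have [i Asg] := spread_cover (A := fun i => (As i / S)%G) p_pr n_gt0 defq cardI
  cHS cAsS sAsHS tiAsS HSg.
exists i; rewrite -(quotientGK (normal_SAs i)).
by rewrite mem_morphpre // (subsetP nSH).
Qed.

Lemma abelem_HS : p.-abelem (H / S).
Proof.
have [cHS cAsS sAsHS tiAsS] := spread_quotient.
exact: (spread_abelem (A := fun i => (As i / S)%G) p_pr n_gt0 defq cardI
  cHS cAsS sAsHS tiAsS).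
Qed.

Lemma sder1S : H^`(1) \subset S.
Proof. exact: der1_min nSH (abelem_abelian abelem_HS). Qed.

Lemma expS g : g \in H -> g ^+ p \in S.
Proof.
move=> Hg; have Ng := subsetP nSH g Hg; apply: coset_idr; first exact: groupX.
have [_ expHS] := abelemP p_pr abelem_HS.
by rewrite morphX //; apply/expHS/mem_quotient.
Qed.

Lemma normal_As i : As i <| H.
Proof. exact: sub_der1_normal (subset_trans sder1S (sSAs i)) (sAsH i). Qed.

(** Commutators and p-th powers of [A i] lie in [S], which meets [A i] trivially. *)
Lemma abelem_A i : p.-abelem (A i).
Proof.
have tiSA g : g \in A i -> g \in S -> g = 1.
  by move=> Ag Sg; apply/set1P; rewrite -[[set 1]](tiAS i) inE Ag.
apply/(abelemP p_pr); split=> [|a Aa].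
  apply/centsP=> a Aa b Ab; apply/commgP/eqP/tiSA; first exact: groupR.
  by apply: (subsetP sder1S); apply: mem_commg; apply: (subsetP (sAH i)).
by apply: tiSA; [apply: groupX | apply/expS/(subsetP (sAH i))].
Qed.

(** * The partition of [H] attached to an index, and maximal subgroups *)

Definition opposite_block i j := (A i * A j) :\: A i.

(** If [a * b = c * d] with [a] and [c] in [A i], then [c^-1 * a * b = d] is in [A k], and [tiAAA]
    forces [d = 1], so the element is in [A i]. *)
Lemma opposite_block_disjoint i j k :
  j != k -> [disjoint opposite_block i j & opposite_block i k].
Proof.
move=> neq_jk; rewrite -setI_eq0; apply/eqP/setP=> g; rewrite in_set0.
apply/negP=> /setIP[/setDP[/mulsgP[a b Aa Ab Eg] nAg] /setDP[/mulsgP[c d Ac Ad Eg'] _]].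
have [Eij|neq_ij] := eqVneq i j.
  by rewrite Eg -Eij in Ab nAg; rewrite groupM in nAg.
have [Eik|neq_ik] := eqVneq i k.
  by rewrite Eg' -Eik in Ad nAg; rewrite groupM in nAg.
have Ed : (c^-1 * a) * b = d by rewrite -mulgA -Eg Eg' mulKg.
have d1 : d = 1 by rewrite -Ed (tiAAA neq_ij neq_jk neq_ik) ?Ed ?groupM ?groupV.
by rewrite Eg' d1 mulg1 Ac in nAg.
Qed.

Lemma opposite_block_sub i j : opposite_block i j \subset H :\: As i.
Proof.
apply/subsetP=> g /setDP[/mulsgP[a b Aa Ab ->] nAab].
have Ha := subsetP (sAH i) a Aa; have Hb := subsetP (sAH j) b Ab.
rewrite inE andbC (groupM Ha Hb) /= groupMl ?(subsetP (sAAs i) a) //.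
have [Eij|neq_ij] := eqVneq i j; first by rewrite -Eij in Ab; rewrite groupM in nAab.
apply: contra nAab => Asb; suff -> : b = 1 by rewrite mulg1.
by apply/set1P; rewrite -[[set 1]](tiAsA neq_ij) inE Asb.
Qed.

Lemma opposite_block_self i : opposite_block i i = set0.
Proof. by rewrite /opposite_block mulGid setDv. Qed.

Lemma card_opposite_block i j (K : {group gT}) :
    i != j -> A i \subset K ->
  #|K :&: opposite_block i j| = (q * #|K :&: A j|.-1)%N.
Proof.
move=> neq_ij sAK; rewrite /opposite_block setIDA cardsD setIC -group_modl //.
rewrite (setIidPr (mulG_subl _ _)) TI_cardMg ?cardA; last first.
  by apply/trivgP; rewrite /= -(tiAA neq_ij) setIS ?subsetIl.
by rewrite setIC -{2}[q]muln1 -mulnBr subn1.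
Qed.

(** The block with [j = i] is empty and each of the q others has q(q - 1) elements; together they
    fill q^3 - q^2. *)
Lemma opposite_block_cover i : \bigcup_j opposite_block i j = H :\: As i.
Proof.
apply/eqP; rewrite eqEcard; apply/andP; split.
  by apply/bigcupsP=> j _; apply: opposite_block_sub.
rewrite (card_bigcup_disjoint (@opposite_block_disjoint i)) (bigD1 i) //=.
rewrite opposite_block_self cards0 add0n.
rewrite (eq_bigr (fun=> q * q.-1)%N) => [|j neq_ji].
  rewrite sum_nat_const cardsD (setIidPr (sAsH i)) card_H card_As.
  by rewrite (eq_card (B := predC1 i)) // cardC1 cardI; nia.
rewrite eq_sym in neq_ji.
have := card_opposite_block neq_ji (sAH i).
have sBH := subset_trans (opposite_block_sub i j) (subsetDl H (As i)).
by rewrite (setIidPr (sAH j)) (setIidPr sBH) cardA.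
Qed.

Lemma card_setD_As i (K : {group gT}) :
    K \subset H -> A i \subset K ->
  #|K :\: As i| = (q * \sum_(j | j != i) #|K :&: A j|.-1)%N.
Proof.
move=> sKH sAK.
have -> : K :\: As i = \bigcup_j (K :&: opposite_block i j).
  by rewrite -big_distrr /= opposite_block_cover setIDA (setIidPl sKH).
rewrite card_bigcup_disjoint => [|j k neq_jk]; last first.
  have := opposite_block_disjoint i neq_jk; rewrite -!setI_eq0 -setIIr => /eqP ->.
  by rewrite setI0.
rewrite (bigD1 i) //= opposite_block_self setI0 cards0 add0n big_distrr /=.
by apply: eq_bigr => j /[1!eq_sym] neq_ij; apply: card_opposite_block.
Qed.

Lemma mem_opposite_block i g :
    g \in H -> g \notin As i ->
  exists j, g \in opposite_block i j.
Proof.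
move=> Hg nAsg; have : g \in H :\: As i by rewrite inE nAsg.
by rewrite -opposite_block_cover => /bigcupP[j _ gij]; exists j.
Qed.

(** An element outside [S] avoids some [As k], hence is a product of elements of two members. An
    element of [S] is moved out of [S] by multiplying it with a nontrivial element of some [A i]. *)
Lemma Kantor_gen (K : {group gT}) : (forall i, A i \subset K) -> H \subset K.
Proof.
move=> sAK; have sHDS : H :\: S \subset K.
  apply/subsetP=> g /setDP[Hg nSg].
  have /card_gt0P[i _] : 0 < #|I| by rewrite cardI.
  have [j neq_ji] := Kantor_other i.
  have [k nAsg] : exists k, g \notin As k.
    case: (boolP (g \in As i)) => [Asig|]; last by exists i.
    by exists j; apply: contra nSg => Asjg; rewrite -(AsI neq_ji) inE Asjg.
  have [l /setDP[/mulsgP[a b Aa Ab ->] _]] := mem_opposite_block Hg nAsg.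
  by rewrite groupM ?(subsetP (sAK k) a) ?(subsetP (sAK l) b).
apply/subsetP=> g Hg; have [Sg|nSg] := boolP (g \in S); last first.
  by apply: (subsetP sHDS); rewrite inE nSg.
have /card_gt0P[i _] : 0 < #|I| by rewrite cardI.
have [a Aa [nta _]] := spread_torsion p_pr n_gt0 defq cardA i.
rewrite -(groupMl g (subsetP (sAK i) a Aa)); apply: (subsetP sHDS).
rewrite inE andbC groupM ?(subsetP (sAH i) a) //= groupMr //.
by apply: contra nta => Sa; rewrite -in_set1 -[[set 1]](tiAS i) inE Aa.
Qed.

Lemma card_maximalI (K B : {group gT}) :
    maximal K H -> B \subset H -> ~~ (B \subset K) ->
  (p * #|K :&: B|)%N = #|B|.
Proof.
move=> maxK sBH nsBK; have nsKH := p_maximal_normal pgroup_H maxK.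
have := mul_cardG K B; rewrite (mulg_normal_maximal nsKH maxK sBH nsBK).
rewrite -(Lagrange (normal_sub nsKH)) (p_maximal_index pgroup_H maxK) -mulnA.
by move/eqP; rewrite eqn_pmul2l ?cardG_gt0 // => /eqP.
Qed.

(* Intersecting K with the partition of H into As i and the blocks A i A j :\: A i
   gives a linear equation for the number of members A j inside K. *)
Lemma card_maximal_members (K : {group gT}) i :
    maximal K H -> ~~ (S \subset K) -> A i \subset K ->
  #|[set j | (j != i) && (A j \subset K)]| = 1%N.
Proof.
move=> maxK nsSK sAK; set m := #|_|.
have sKH : K \subset H := proper_sub (maxgroupp maxK).
have pKS := card_maximalI maxK sSH nsSK; rewrite cardS in pKS.
set r := #|K :&: S| in pKS.
have r_gt0 : 0 < r by apply: cardG_gt0.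
have lt_rq : r < q by rewrite -pKS -{1}[r]mul1n ltn_pmul2r ?prime_gt1.
have cardK : #|K| = (r * q * q)%N.
  apply/eqP; rewrite -(eqn_pmul2r (prime_gt0 p_pr)).
  rewrite -{1}(p_maximal_index pgroup_H maxK) (Lagrange sKH) card_H -{1}pKS.
  by apply/eqP; lia.
have cardKAs : #|K :&: As i| = (q * r)%N.
  rewrite -defAs setIC -group_modl // TI_cardMg ?cardA; first by rewrite /= setIC.
  by apply/trivgP; rewrite /= -(tiAS i) setIS ?subsetIl.
have := card_setD_As sKH sAK; rewrite cardsD cardKAs cardK.
(* A member not inside [K] meets it in index p, hence in [r] elements; a member inside [K] adds a
   surplus of [q - r]. *)
rewrite (eq_bigr (fun j => r.-1 + (A j \subset K) * (q - r))%N) => [|j neq_ji].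
  rewrite big_split /= sum_nat_const (eq_card (B := predC1 i)) // cardC1 cardI.
  rewrite -big_distrl /= -big_mkcondr sum1_card.
  rewrite (_ : #|_| = m); last by apply: eq_card => j; rewrite !inE.
  by apply: members_equation.
have [sAjK|nsAjK] := boolP (A j \subset K).
  by rewrite (setIidPr sAjK) cardA mul1n; lia.
have /eqP := card_maximalI maxK (sAH j) nsAjK.
by rewrite cardA -{1}pKS eqn_pmul2l ?prime_gt0 // => /eqP ->; rewrite addn0.
Qed.

(** * Parity arguments: the Frattini subgroup and the centre *)

Let odd_q : odd q.
Proof. by rewrite defq oddX p_odd orbT. Qed.

(* Dual hyperoval argument.  A maximal K missing S yields the q subgroups
   (K :&: As i) A j, j != i, each of which contains exactly two members of the
   family, neither being A i; so the q indices j != i come in pairs. *)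
Lemma sub_S_Phi : S \subset 'Phi(H).
Proof.
apply/bigcapsP=> K /predU1P[->//|maxK]; apply/idPn=> nsSK.
(* The [A i] generate [H], so [K], not containing [S], cannot contain all of them. *)
have [i nsAK] : exists i, ~~ (A i \subset K).
  apply/existsP; rewrite -negb_forall; apply: contra nsSK => /forallP sAK.
  exact: subset_trans sSH (Kantor_gen sAK).
have nsKH := p_maximal_normal pgroup_H maxK.
pose M := (K :&: As i)%G; have nsMH : M <| H := normalI nsKH (normal_As i).
have pM : (p * #|M|)%N = (q * q)%N.
  rewrite -(card_As i); apply: card_maximalI (sAsH i) _ => //.
  by apply: contra nsSK; apply: subset_trans (sSAs i).
pose L j := (M <*> A j)%G.
have defL j : L j :=: M * A j.
  by rewrite /= norm_joinEr // (subset_trans (sAH j)) ?normal_norm.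
have LI j : j != i -> L j :&: As i = M.
  move=> neq_ji; rewrite defL -group_modl ?subsetIr //= [A j :&: _]setIC.
  rewrite tiAsA 1?eq_sym //.
  by rewrite mulg1.
have cardL j : j != i -> (p * #|L j|)%N = #|H|.
  move=> neq_ji; rewrite defL TI_cardMg.
    by rewrite mulnA pM cardA card_H.
  apply/trivgP; rewrite /= -(tiAsA (i := i) (j := j)) 1?eq_sym //.
  by rewrite setSI ?subsetIr.
have sLH j : L j \subset H by rewrite join_subG normal_sub ?sAH.
have maxL j : j != i -> maximal (L j) H.
  move=> neq_ji; apply: p_index_maximal (sLH j) _.
  by rewrite -divgS // -(cardL j neq_ji) mulnK ?cardG_gt0.
(* Within [As i] the group [L j] is just [M]; hence it contains neither [S] nor [A i]. *)
have sLK j (B : {group gT}) :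
    j != i -> B \subset As i -> B \subset L j -> B \subset K.
  move=> neq_ji sBAs sBL; apply: subset_trans (subsetIl K (As i)).
  by rewrite -[K :&: As i](LI j neq_ji) subsetI sBL.
have /negP[] : ~~ odd #|[set~ i]|; last by rewrite cardsC1 cardI.
apply: (@perfect_matching_even _ _ (fun j k => (j != k) && (L j == L k))).
- by move=> j k; rewrite eq_sym [L j == _]eq_sym.
- by move=> j; rewrite eqxx.
move=> j; rewrite !inE => neq_ji.
have nsSL : ~~ (S \subset L j) := contra (sLK j S neq_ji (sSAs i)) nsSK.
have nsAL : ~~ (A i \subset L j) := contra (sLK j (A i) neq_ji (sAAs i)) nsAK.
have sAL : A j \subset L j by apply: joing_subr.
(* The partner of [j] is the one further member inside [L j]; then [L k] lies in [L j] and has the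
   same order. *)
have /eqP/cards1P[k defk] := card_maximal_members (maxL j neq_ji) nsSL sAL.
have := set11 k.
rewrite -defk inE => /andP[neq_kj sAkL].
have neq_ki : k != i by apply: contraNneq nsAL => <-.
exists k; split=> [|k' [_]].
  rewrite !inE neq_ki eq_sym neq_kj; split=> //=.
  rewrite eq_sym -val_eqE /= eqEcard join_subG joing_subl sAkL /=.
  by rewrite -(leq_pmul2l (prime_gt0 p_pr)) !cardL.
case/andP=> neq_jk' /eqP Lk'; apply/esym/set1P; rewrite -defk inE eq_sym neq_jk' Lk'.
exact: joing_subr.
Qed.

Lemma Phi_H : 'Phi(H) = S.
Proof.
apply/eqP; rewrite eqEsubset sub_S_Phi andbT.
exact: Phi_min pgroup_H nSH abelem_HS.
Qed.

(* A central t in As i outside A i and S lies, for each j != i, in A j A k for a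
   unique k; centrality makes this pairing of the q indices j != i symmetric. *)
Lemma central_As i t : t \in 'Z(H) -> t \in As i -> (t \in A i) || (t \in S).
Proof.
case/centerP=> Ht cHt Ast; apply/norP=> -[nAt nSt].
have /negP[] : ~~ odd #|[set~ i]|; last by rewrite cardsC1 cardI.
have symA j k : t \in A j * A k -> t \in A k * A j.
  case/mulsgP=> a b Aa Ab Et; have := cHt a (subsetP (sAH j) a Aa).
  by rewrite /commute {1}Et -mulgA => /mulgI <-; rewrite mem_mulg.
apply: (@perfect_matching_even _ _ (fun j k => (j != k) && (t \in A j * A k))).
- by move=> j k; rewrite eq_sym; congr (_ && _); apply/idP/idP; apply: symA.
- by move=> j; rewrite eqxx.
move=> j; rewrite !inE => neq_ji.
have nAsjt : t \notin As j.
  by apply: contra nSt => Asjt; rewrite -(AsI neq_ji) inE Asjt.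
have nAjt : t \notin A j by apply: contra nAsjt; apply: (subsetP (sAAs j)).
have [k tjk] := mem_opposite_block Ht nAsjt.
have /setDP[tAA _] := tjk.
exists k; split=> [|k' [_ /andP[neq_jk' tAA']]].
  rewrite !inE tAA andbT; split; last first.
    by apply: contraNneq nAjt => Ejk; rewrite -Ejk mulGid in tAA.
  (* If [k] were [i], the factor of [t] in [A j] would lie in [As i], hence be trivial, and [t]
     would be in [A i]. *)
  apply: contraNneq nAt => Eki; rewrite {}Eki in tAA.
  case/mulsgP: tAA => a b Aa Ab Et; suff a1 : a = 1 by rewrite Et a1 mul1g.
  apply/set1P; rewrite eq_sym in neq_ji; rewrite -[[set 1]](tiAsA neq_ji) inE Aa.
  by rewrite andbT -(groupMr a (subsetP (sAAs i) b Ab)) -Et.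
apply/eqP; apply/idPn=> /(opposite_block_disjoint j).
rewrite -setI_eq0 => /eqP/setP/(_ t).
by rewrite in_set0 inE tjk inE nAjt tAA'.
Qed.

(** Write a central element as [a * s] and take [r] nontrivial in [S]. By [central_As], [a * r] is
    in [S], and then so is [a], or in [A i], which would put [r] in [A i :&: S]. *)
Lemma center_H : S \subset 'Z(H) -> S :=: 'Z(H).
Proof.
move=> sSZ; apply/eqP; rewrite eqEsubset sSZ /=; apply/subsetP=> t Zt.
have [i] := Kantor_cover (subsetP (center_sub H) t Zt).
rewrite -defAs => /mulsgP[a s Aa Ss Et]; rewrite Et groupMr //.
have Za : a \in 'Z(H) by rewrite -(groupMr a (subsetP sSZ s Ss)) -Et.
have [r Sr ntr] : exists2 r, r \in S & r != 1.
  by apply/trivgPn; rewrite -cardG_gt1 cardS (ltn_trans _ q_gt2).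
have Zar : a * r \in 'Z(H) := groupM Za (subsetP sSZ r Sr).
have Asar := groupM (subsetP (sAAs i) a Aa) (subsetP (sSAs i) r Sr).
have /orP[|] := central_As Zar Asar; last by rewrite groupMr.
rewrite groupMl // => Ar; case/eqP: ntr.
by apply/set1P; rewrite -[[set 1]](tiAS i) inE Ar.
Qed.

(** [H] has class at most 2 and is generated by the elementary abelian [A i]; as p is odd,
    ['Ohm_1(H)] then has exponent dividing p. *)
Lemma exponent_H : S \subset 'Z(H) -> exponent H = p.
Proof.
move=> sSZ; have sHOhm : H \subset 'Ohm_1(H).
  apply: Kantor_gen => i; apply: subset_trans (OhmS 1 (sAH i)).
  by rewrite (Ohm1_id (abelem_A i)).
have expH : exponent H %| p.
  apply: dvdn_trans (exponentS sHOhm) _; apply: exponent_Ohm1_class2 => //.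
    exact: pgroup_H.
  by rewrite nil_class2 (subset_trans sder1S).
apply/prime_nt_dvdP => //; rewrite -dvdn1 -trivg_exponent -cardG_gt1 card_H.
by have := q_gt2; nia.
Qed.

(** Since ['Phi(H)] is [S], a special [H] has centre [S]. Conversely, when [S] is central, exponent
    p kills ['Mho^1(H)], so ['Phi(H)] is the derived subgroup. *)
Lemma special_iff_central :
  special_pgroup p H /\ exponent H = p <-> S \subset 'Z(H).
Proof.
split=> [[[_ [PhiZ _] _] _]|sSZ]; first by rewrite -PhiZ Phi_H.
have defZ := center_H sSZ; have expH := exponent_H sSZ.
have expZ : p.-abelem 'Z(H).
  rewrite abelemE // center_abelian -expH /=; exact: exponentS (center_sub H).
split=> //; split=> //; first exact: pgroup_H.
have PhiZ : 'Phi(H) = 'Z(H) by rewrite Phi_H.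
split=> //; rewrite -PhiZ (Phi_joing pgroup_H).
have /trivgP -> : 'Mho^1(H) \subset [1 gT]; last by rewrite joingG1.
rewrite (MhoE _ pgroup_H) gen_subG; apply/subsetP=> _ /imsetP[g Hg ->].
by rewrite inE expn1 -expH expg_exponent.
Qed.

Lemma abelian_As_iff_central :
  (forall i, abelian (As i)) <-> S \subset 'Z(H).
Proof.
split=> [abAs|sSZ i].
  have /card_gt0P[i _] : 0 < #|I| by rewrite cardI.
  have [j neq_ji] := Kantor_other i.
  rewrite subsetI sSH /= -(defH neq_ji) centM subsetI; apply/andP; split.
    exact: subset_trans (sSAs j) (abAs j).
  exact: subset_trans (sSAs i) (subset_trans (abAs i) (centS (sAAs i))).
have cAS : S \subset 'C(A i).
  exact: subset_trans sSZ (subset_trans (subsetIr _ _) (centS (sAH i))).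
rewrite -defAs abelianM (abelem_abelian (abelem_A i)) cAS andbT /=.
exact: subset_trans sSZ (subset_trans (subsetIr _ _) (centS sSH)).
Qed.

Lemma central_of_normalised :
  (forall i, S \subset 'N(A i)) -> S \subset 'Z(H).
Proof.
move=> nAS; rewrite subsetI sSH centsC; apply: Kantor_gen => i.
apply/commG1P/trivgP; rewrite /= -(tiAS i) subsetI commg_subl commg_subr nAS /=.
exact: subset_trans (sAH i) nSH.
Qed.

End SkewKantorFamily.

(** * Lines, projections and automorphisms in a quadrangle of order (q, q) *)

Lemma imset_permM (T : finType) (g h : {perm T}) (B : {set T}) :
  (g * h) @: B = h @: (g @: B).
Proof. by rewrite -imset_comp; apply: eq_imset => y; rewrite /= permM. Qed.

Lemma imset_permK (T : finType) (g : {perm T}) (B : {set T}) :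
  g^-1 @: (g @: B) = B.
Proof. by rewrite -imset_permM mulgV (eq_imset _ (@perm1 T)) imset_id. Qed.

Section Quadrangle.

Variables (P : finType) (Lines : {set {set P}}) (q : nat).
Hypotheses (q_gt1 : 1 < q) (GQ : is_GQ Lines q q).
Local Notation coll := (collinear Lines).

Lemma collP y z :
  reflect (exists2 l, l \in Lines & y \in l /\ z \in l) (coll y z).
Proof.
apply: (iffP exists_inP) => [[l Ll /andP[]]|[l Ll [ly lz]]]; exists l => //.
by rewrite ly.
Qed.

Lemma collC y z : coll y z = coll z y.
Proof. by apply/collP/collP=> -[l Ll [ly lz]]; exists l. Qed.

Lemma line_coll l y z : l \in Lines -> y \in l -> z \in l -> coll y z.
Proof. by move=> Ll ly lz; apply/collP; exists l. Qed.

Lemma card_line l : l \in Lines -> #|l| = q.+1.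
Proof. by case: GQ => H _ _ _; apply: H. Qed.

Lemma line_eq y z l1 l2 :
    y != z -> l1 \in Lines -> l2 \in Lines ->
    y \in l1 -> z \in l1 -> y \in l2 -> z \in l2 ->
  l1 = l2.
Proof. by case: GQ => _ _ + _; apply. Qed.

Lemma no_triangle l y v w :
    l \in Lines -> y \notin l -> v \in l -> w \in l ->
    coll y v -> coll y w ->
  v = w.
Proof.
case: GQ => _ _ _ proj_l Ll nly lv lw yv yw.
by have [w' [_ Uw']] := proj_l y l Ll nly; rewrite -(Uw' v) // -(Uw' w).
Qed.

Lemma projection_exists l y :
  l \in Lines -> exists2 w, w \in l & coll y w.
Proof.
move=> Ll; have [ly|nly] := boolP (y \in l).
  by exists y => //; apply: (line_coll Ll ly ly).
by case: GQ => _ _ _ /(_ y l Ll nly)[w [[lw yw] _]]; exists w.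
Qed.

Lemma other_line l y :
  exists l', [/\ l' \in Lines, y \in l' & l' != l].
Proof.
case: GQ => _ /(_ y) cardy _ _.
have : 0 < #|[set l in Lines | y \in l] :\ l|.
  have := cardsD1 l [set l in Lines | y \in l]; rewrite cardy.
  by case: (l \in _) => /=; lia.
by case/card_gt0P=> l' /[!inE]/and3P[neq_l' Ll' ly]; exists l'.
Qed.

Lemma third_point l y z :
  l \in Lines -> exists w, [/\ w \in l, w != y & w != z].
Proof.
move=> Ll; have : 0 < #|l :\ y :\ z|.
  have := cardsD1 y l; have := cardsD1 z (l :\ y); rewrite (card_line Ll).
  by case: (y \in _); case: (z \in _) => /=; lia.
by case/card_gt0P=> w /[!inE]/and3P[]; exists w.
Qed.

Lemma Aut_line g l : g \in Defs.Aut Lines -> l \in Lines -> g @: l \in Lines.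
Proof. by rewrite inE => /forall_inP; apply. Qed.

Lemma Aut_coll g y z : g \in Defs.Aut Lines -> coll y z -> coll (g y) (g z).
Proof.
move=> Autg /collP[l Ll [ly lz]].
by apply: (line_coll (Aut_line Autg Ll)); apply: imset_f.
Qed.

Lemma AutM g h :
  g \in Defs.Aut Lines -> h \in Defs.Aut Lines -> g * h \in Defs.Aut Lines.
Proof.
move=> Autg Auth; rewrite inE; apply/forall_inP=> l Ll.
by rewrite imset_permM !Aut_line.
Qed.

(** * Rigidity of automorphisms fixing all lines on [x] and all points of [L] *)

Section Rigidity.

Variables (x : P) (L : {set P}) (k : {perm P}).
Hypotheses (Autk : k \in Defs.Aut Lines) (LL : L \in Lines) (Lx : x \in L).
Hypothesis fix_x : forall l, l \in Lines -> x \in l -> k @: l = l.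
Hypothesis fix_L : forall v, v \in L -> k v = v.

(** The projection [u] of [x] onto [N] is fixed, because [w] and the line joining [x] to [u] are. So
    [N] is fixed, and a point [r] of [N] is the projection onto [N] of a fixed point of [L]. *)
Lemma fix_skew_line w N r :
    ~~ coll x w -> k w = w -> N \in Lines -> w \in N ->
    (forall v, v \in N -> v \notin L) ->
  r \in N -> k r = r.
Proof.
move=> nxw kw LN Nw skewN Nr.
have [u Nu xu] := projection_exists x LN.
have [M LM [Mx Mu]] := collP _ _ xu.
have nMw : w \notin M by apply: contra nxw; apply: (line_coll LM Mx).
have wu : coll w u := line_coll LN Nw Nu.
have ku : k u = u.
  apply: (no_triangle LM nMw _ Mu _ wu); first by rewrite -(fix_x LM Mx) imset_f.
  by rewrite -kw Aut_coll.
have kN : k @: N = N.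
  have neq_wu : w != u by apply: contraNneq nxw => ->.
  apply: (line_eq neq_wu (Aut_line Autk LN) LN _ _ Nw Nu).
    by rewrite -kw imset_f.
  by rewrite -ku imset_f.
have [v Lv rv] := projection_exists r LL.
have nNv : v \notin N by apply/negP=> /skewN; rewrite Lv.
apply: (no_triangle LN nNv _ Nr _ _); first by rewrite -kN imset_f.
  by rewrite collC -(fix_L Lv) Aut_coll.
by rewrite collC.
Qed.

(** A line [l] on [y] other than [L] carries a second fixed point [r], reached from [z] along two
    lines [N] and [N'] that miss [L]. *)
Lemma fix_pencil z y l :
    ~~ coll x z -> k z = z -> y \in L -> coll z y ->
    l \in Lines -> y \in l ->
  k @: l = l.
Proof.
move=> nxz kz Ly zy Ll ly.
have [->|neq_lL] := eqVneq l L; first exact: fix_x.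
have nLz : z \notin L by apply: contra nxz; apply: (line_coll LL Lx).
have [U LU [Uz Uy]] := collP _ _ zy.
have neq_zy : z != y by apply: contraNneq nLz => ->.
have [N [LN Nz neq_NU]] := other_line U z.
have nNy : y \notin N.
  by apply: contra neq_NU => Ny; apply/eqP; apply: (line_eq neq_zy _ _ _ _ _ _).
have skewN v : v \in N -> v \notin L.
  move=> Nv; apply: contra nNy => Lv.
  suff <- : v = y by [].
  by apply: (no_triangle LL nLz Lv Ly _ zy); apply: (line_coll LN Nz Nv).
have [u Nu xu] := projection_exists x LN.
(* Avoiding [u] keeps [t] non-collinear with [x], so that [fix_skew_line] applies again at [t];
   avoiding [z] keeps it non-collinear with [y]. *)
have [t [Nt neq_tz neq_tu]] := third_point z u LN.
have nNx : x \notin N by apply: contra nxz => Nx; apply: (line_coll LN Nx Nz).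
have nxt : ~~ coll x t.
  by apply: contra neq_tu => xt; rewrite (no_triangle LN nNx Nt Nu xt xu).
have kt : k t = t by apply: (fix_skew_line nxz kz LN Nz skewN Nt).
have nty : ~~ coll t y.
  apply: contra neq_tz => ty; apply/eqP.
  by apply: (no_triangle LN nNy Nt Nz _ _); rewrite collC.
have [r lr tr] := projection_exists t Ll.
have [N' LN' [N't N'r]] := collP _ _ tr.
have neq_ry : r != y by apply: contraNneq nty => <-.
have nLr : r \notin L.
  apply: contra neq_lL => Lr; apply/eqP; exact: (line_eq neq_ry _ _ _ _ _ _).
have skewN' v : v \in N' -> v \notin L.
  move=> N'v; apply: contra nty => Lv.
  suff <- : v = y by apply: (line_coll LN' N't N'v).
  apply: (no_triangle LL nLr Lv Ly); first exact: (line_coll LN' N'r N'v).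
  exact: (line_coll Ll lr ly).
have kr := fix_skew_line nxt kt LN' N't skewN' N'r.
apply: (line_eq neq_ry (Aut_line Autk Ll) Ll _ _ lr ly).
  by rewrite -kr imset_f.
by rewrite -(fix_L Ly) imset_f.
Qed.

End Rigidity.

End Quadrangle.

(** * The Kantor family of an elation quadrangle at the base point [z] *)

Section ElationQuadrangle.

Variables (P : finType) (Lines : {set {set P}}) (q : nat).
Variables (x : P) (H S : {group {perm P}}) (z : P).
Hypotheses (q_gt1 : 1 < q) (GQ : is_GQ Lines q q) (EGQ : is_EGQ Lines x H).
Hypotheses (sSH : S \subset H) (cardS : #|S| = q).
Hypothesis symS : forall g, g \in S -> is_symmetry Lines x g.
Hypothesis opp_z : z \in opp_pts Lines x.
Local Notation coll := (collinear Lines).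

Lemma H_Aut h : h \in H -> h \in Defs.Aut Lines.
Proof. by case: EGQ => /subsetP sHA _ _; apply: sHA. Qed.

Lemma H_line h l : h \in H -> l \in Lines -> x \in l -> h @: l = l.
Proof. by case: EGQ => _ + _; apply. Qed.

Lemma H_fix_x h : h \in H -> h x = x.
Proof.
move=> Hh; have [l [Ll lx _]] := other_line q_gt1 GQ set0 x.
have [l' [Ll' l'x neq_l'l]] := other_line q_gt1 GQ l x.
apply/eqP; apply: contraNT neq_l'l => neq_hx; apply/eqP.
apply: (line_eq GQ neq_hx) => //.
  by rewrite -(H_line Hh Ll' l'x) imset_f.
by rewrite -(H_line Hh Ll lx) imset_f.
Qed.

Lemma H_coll h y w : h \in H -> coll (h y) (h w) = coll y w.
Proof.
move=> Hh; apply/idP/idP; last exact: Aut_coll (H_Aut Hh).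
by move/(Aut_coll (H_Aut (groupVr Hh))); rewrite !permK.
Qed.

Lemma H_collx h y : h \in H -> coll x (h y) = coll x y.
Proof. by move=> Hh; rewrite -{1}(H_fix_x Hh) H_coll. Qed.

Lemma H_free h w : h \in H -> ~~ coll x w -> h w = w -> h = 1.
Proof.
case: EGQ => _ _ reg Hh nxw hw.
have oppw : w \in opp_pts Lines x by rewrite inE.
have [g [_ Ug]] := reg w w oppw oppw.
by rewrite -(Ug h) // -(Ug 1) // perm1.
Qed.

Lemma H_trans w w' : ~~ coll x w -> ~~ coll x w' -> exists2 h, h \in H & h w = w'.
Proof.
case: EGQ => _ _ reg nxw nxw'.
by have [||h [[Hh hw] _]] := reg w w'; rewrite ?inE //; exists h.
Qed.

Lemma S_fix s y : s \in S -> coll x y -> s y = y.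
Proof.
by move=> /symS/andP[_ /forallP/(_ y)/implyP sy] xy; apply/eqP/sy.
Qed.

Lemma base_opp : ~~ coll x z.
Proof. by move: opp_z; rewrite inE. Qed.

Definition pencil : finType := {l : {set P} | (l \in Lines) && (z \in l)}.

Implicit Types i j k : pencil.

Lemma card_pencil : #|pencil| = q.+1.
Proof.
rewrite card_sig; case: GQ => _ /(_ z) <- _ _.
by apply: eq_card => l; rewrite !inE.
Qed.

Lemma pencil_line i : val i \in Lines.
Proof. by case/andP: (valP i). Qed.

Lemma pencil_z i : z \in val i.
Proof. by case/andP: (valP i). Qed.

(** This is the projection of [x] onto the line; by [footP] the default [x] is never taken. *)
Definition foot i : P := odflt x [pick w in val i | coll x w].

Lemma footP i : (foot i \in val i) /\ coll x (foot i).
Proof.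
rewrite /foot; case: pickP => [w /andP[] //|no_w].
have [w iw xw] := projection_exists GQ x (pencil_line i).
by have := no_w w; rewrite iw xw.
Qed.

Lemma foot_uniq i w : w \in val i -> coll x w -> w = foot i.
Proof.
move=> iw xw; have [iu xu] := footP i.
apply: (no_triangle GQ (pencil_line i) _ iw iu xw xu).
by apply: contra base_opp => ix; apply: (line_coll (pencil_line i) ix (pencil_z i)).
Qed.

Lemma foot_line i :
  exists L, [/\ L \in Lines, x \in L, foot i \in L & z \notin L].
Proof.
have [_ /collP[L LL [Lx Lu]]] := footP i; exists L; split=> //.
by apply: contra base_opp; apply: (line_coll LL Lx).
Qed.

Lemma foot_neq i w : ~~ coll x w -> w != foot i.
Proof. by apply: contraNneq => ->; case: (footP i). Qed.

Lemma foot_neq_x i : foot i != x.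
Proof.
have [iu _] := footP i; apply: contraNneq base_opp => <-.
exact: (line_coll (pencil_line i) iu (pencil_z i)).
Qed.

Lemma foot_notin i j : i != j -> foot i \notin val j.
Proof.
have [iu xu] := footP i; apply: contra => ju; apply/eqP/val_inj.
exact: (line_eq GQ (foot_neq i base_opp) (pencil_line i) (pencil_line j)
  (pencil_z i) iu (pencil_z j) ju).
Qed.

Definition Kantor i : {group {perm P}} := 'N_H(val i | 'P)%G.
Definition Kantor_star i : {group {perm P}} := 'C_H[foot i | 'P]%G.

Lemma KantorE i h : (h \in Kantor i) = (h \in H) && (h @: val i == val i).
Proof.
rewrite inE; congr (_ && _); rewrite !inE /=; apply/idP/eqP => [sU|hU].
  apply/eqP; rewrite eqEcard card_imset ?leqnn ?andbT; last exact: perm_inj.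
  by apply/subsetP=> _ /imsetP[w iw ->]; have := subsetP sU w iw; rewrite inE.
by apply/subsetP=> w iw; rewrite inE /= /aperm -hU imset_f.
Qed.

Lemma KantorP i h : h \in Kantor i -> h \in H /\ h @: val i = val i.
Proof. by rewrite KantorE => /andP[-> /eqP]. Qed.

Lemma Kantor_starE i h :
  (h \in Kantor_star i) = (h \in H) && (h (foot i) == foot i).
Proof. by rewrite inE; congr (_ && _); apply/astab1P/eqP. Qed.

Lemma sub_Kantor_star i : Kantor i \subset Kantor_star i.
Proof.
apply/subsetP=> h /KantorP[Hh hi]; rewrite Kantor_starE Hh /=; apply/eqP.
have [iu xu] := footP i; apply: foot_uniq; last by rewrite H_collx.
by rewrite -hi imset_f.
Qed.

(** [foot i] and its image both lie on the line [L] joining [x] to [foot i], and both are collinear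
    with [h z]; hence they agree, and [h] maps [val i] to the line through [foot i] and [h z]. *)
Lemma mem_Kantor i h : h \in H -> h z \in val i -> h \in Kantor i.
Proof.
move=> Hh ihz; have [iu xu] := footP i.
have [L [LL Lx Lu nLz]] := foot_line i.
have nxhz : ~~ coll x (h z) by rewrite H_collx ?base_opp.
have hu : h (foot i) = foot i.
  apply: (no_triangle GQ (l := L) (y := h z)) => //.
  - by apply: contra nxhz; apply: (line_coll LL Lx).
  - by rewrite -(H_line Hh LL Lx) imset_f.
  - by rewrite H_coll // (line_coll (pencil_line i) (pencil_z i) iu).
  exact: (line_coll (pencil_line i) ihz iu).
rewrite KantorE Hh /=; apply/eqP.
apply: (line_eq GQ (foot_neq i nxhz) _ (pencil_line i) _ _ ihz iu).
- exact: Aut_line (H_Aut Hh) (pencil_line i).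
- by rewrite imset_f ?pencil_z.
by rewrite -hu imset_f.
Qed.

Lemma Kantor_transitive i w :
  w \in val i -> w != foot i -> exists2 h, h \in Kantor i & h z = w.
Proof.
move=> iw neq_w; have nxw : ~~ coll x w.
  by apply: contra neq_w => xw; apply/eqP/foot_uniq.
have [h Hh hz] := H_trans base_opp nxw; exists h => //.
by apply: mem_Kantor; rewrite ?hz.
Qed.

Lemma card_Kantor i : #|Kantor i| = q.
Proof.
have injz : {in Kantor i &, injective (fun h : {perm P} => h z)}.
  move=> g h /KantorP[Hg _] /KantorP[Hh _] Egh; apply/eqP; rewrite eq_mulgV1.
  apply/eqP/(H_free _ base_opp); first by rewrite groupM ?groupV.
  by rewrite permM Egh permK.
rewrite -(card_in_imset injz); have [iu xu] := footP i.
have -> : [set h z | h : {perm P} in Kantor i] = val i :\ foot i.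
  apply/setP=> w; apply/imsetP/setD1P=> [[h /KantorP[Hh hi] ->]|[neq_w iw]].
    by rewrite foot_neq ?H_collx ?base_opp // -hi imset_f ?pencil_z.
  by have [h Kh hz] := Kantor_transitive iw neq_w; exists h.
by have := cardsD1 (foot i) (val i); rewrite iu (card_line GQ) ?pencil_line // => -[].
Qed.

(** An element fixing [foot i] and [val j] fixes the projection of [foot i] onto [val j], which is
    [z]. *)
Lemma TI_Kantor_star i j : i != j -> Kantor_star i :&: Kantor j = 1.
Proof.
move=> neq_ij; apply/trivgP/subsetP=> h /setIP[]; rewrite Kantor_starE.
case/andP=> Hh /eqP hu /KantorP[_ hj]; rewrite inE; apply/eqP/(H_free Hh base_opp).
have [iu _] := footP i.
have uz : coll (foot i) z := line_coll (pencil_line i) iu (pencil_z i).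
apply: (no_triangle GQ (pencil_line j) (foot_notin neq_ij) _ (pencil_z j) _ uz).
  by rewrite -hj imset_f ?pencil_z.
by rewrite -hu H_coll.
Qed.

(** If [(a * b) z] differs from [z], it is collinear with both [z] and [b z] on [val j]; having no
    triangles gives [b z = z], so [b = 1] and [a] lies in two members. *)
Lemma TI_Kantor i j k a b :
    i != j -> j != k -> i != k ->
    a \in Kantor i -> b \in Kantor j -> a * b \in Kantor k ->
  a * b = 1.
Proof.
move=> neq_ij neq_jk neq_ik Ka Kb Kab.
have [Ha ai] := KantorP Ka; have [Hb bj] := KantorP Kb; have [Hab abk] := KantorP Kab.
apply: (H_free Hab base_opp); apply/eqP/idPn=> neq_z.
have kz : (a * b) z \in val k by rewrite -abk imset_f ?pencil_z.
have jbz : b z \in val j by rewrite -bj imset_f ?pencil_z.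
have njz : (a * b) z \notin val j.
  apply: contra neq_jk => jz; apply/eqP/val_inj.
  exact: (line_eq GQ neq_z (pencil_line j) (pencil_line k) jz (pencil_z j)
    kz (pencil_z k)).
have Ebz : b z = z.
  apply: (no_triangle GQ (pencil_line j) njz jbz (pencil_z j)).
    rewrite permM H_coll //; apply: (line_coll (pencil_line i) _ (pencil_z i)).
    by rewrite -ai imset_f ?pencil_z.
  exact: (line_coll (pencil_line k) kz (pencil_z k)).
have b1 := H_free Hb base_opp Ebz; case/eqP: neq_z.
suff -> : a * b = 1 by rewrite perm1.
apply/set1P; rewrite -[[set 1]](TI_Kantor_star neq_ik) inE Kab andbT.
by rewrite b1 mulg1 (subsetP (sub_Kantor_star i)).
Qed.

Lemma exists_other_pencil i : exists j, j != i.
Proof. by apply: exists_neq; rewrite card_pencil ltnS ltnW. Qed.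

Lemma S_sub_star i : S \subset Kantor_star i.
Proof.
apply/subsetP=> s Ss; rewrite Kantor_starE (subsetP sSH) //=; apply/eqP.
by apply: S_fix => //; case: (footP i).
Qed.

Lemma TI_Kantor_S i : Kantor i :&: S = 1.
Proof.
have [j neq_ji] := exists_other_pencil i; apply/trivgP.
by rewrite /= -(TI_Kantor_star neq_ji) setIC setSI ?S_sub_star.
Qed.

Lemma star_line_image i h :
  h \in Kantor_star i -> [/\ h @: val i \in Lines & foot i \in h @: val i].
Proof.
rewrite Kantor_starE => /andP[Hh /eqP hu]; have [iu _] := footP i.
by split; [apply: Aut_line (H_Aut Hh) (pencil_line i) | rewrite -hu imset_f].
Qed.

(** [S] meets the stabilizer of [val i] trivially, so it moves [val i] to q distinct lines on
    [foot i], none of them [L]; there are no others. *)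
Lemma S_transitive i L l :
    L \in Lines -> x \in L -> foot i \in L ->
    l \in Lines -> foot i \in l -> l != L ->
  exists2 s, s \in S & s @: val i = l.
Proof.
move=> LL Lx Lu Ll lu neq_lL.
have injU : {in S &, injective (fun s : {perm P} => s @: val i)}.
  move=> s t Ss St Est; apply/eqP; rewrite eq_mulgV1 -in_set1.
  rewrite -[[set 1]](TI_Kantor_S i) inE KantorE.
  rewrite !groupM ?groupV ?(subsetP sSH s) ?(subsetP sSH t) //=.
  by rewrite imset_permM Est imset_permK eqxx.
have sub : [set s @: val i | s : {perm P} in S]
    \subset [set l in Lines | foot i \in l] :\ L.
  apply/subsetP=> _ /imsetP[s Ss ->].
  have [Ls ls] := star_line_image (subsetP (S_sub_star i) s Ss).
  rewrite !inE Ls ls !andbT; apply/eqP => sL.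
  have : coll x (s z) by apply: (line_coll LL Lx); rewrite -sL imset_f ?pencil_z.
  by rewrite H_collx ?(subsetP sSH) // (negbTE base_opp).
have cardT : #|[set l in Lines | foot i \in l] :\ L| = q.
  have := cardsD1 L [set l in Lines | foot i \in l].
  by case: GQ => _ /(_ (foot i)) -> _ _; rewrite inE LL Lu => -[].
have /eqP Eim : [set s @: val i | s : {perm P} in S]
    == [set l in Lines | foot i \in l] :\ L.
  by rewrite eqEcard sub cardT card_in_imset ?cardS /=.
have : l \in [set l in Lines | foot i \in l] :\ L by rewrite !inE neq_lL Ll.
by rewrite -Eim => /imsetP[s Ss ->]; exists s.
Qed.

Lemma mulg_Kantor_S i : Kantor i * S = Kantor_star i.
Proof.
apply/eqP; rewrite eqEsubset mul_subG ?sub_Kantor_star ?S_sub_star //=.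
apply/subsetP=> h Kh; have [Lh lh] := star_line_image Kh.
have [L [LL Lx Lu nLz]] := foot_line i.
have Hh : h \in H by move: Kh; rewrite Kantor_starE => /andP[].
have neq_hL : h @: val i != L.
  apply/eqP=> hL; have : coll x (h z).
    by apply: (line_coll LL Lx); rewrite -hL imset_f ?pencil_z.
  by rewrite H_collx // (negbTE base_opp).
have [s Ss sU] := S_transitive LL Lx Lu Lh lh neq_hL.
rewrite -(mulgKV s h) mem_mulg // KantorE.
rewrite groupM ?groupV ?(subsetP sSH s) //=.
by rewrite imset_permM -sU imset_permK.
Qed.

Lemma Kantor_transitive_line i j L v :
    i != j -> L \in Lines -> x \in L -> foot i \in L -> v \in L -> v != x ->
  exists2 b, b \in Kantor j & b (foot i) = v.
Proof.
move=> neq_ij LL Lx Lu Lv neq_vx.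
have injU : {in Kantor j &, injective (fun b : {perm P} => b (foot i))}.
  move=> b c Kb Kc Ebc; apply/eqP; rewrite eq_mulgV1 -in_set1.
  rewrite -[[set 1]](TI_Kantor_star neq_ij) inE andbC groupM ?groupV //=.
  have [[Hb _] [Hc _]] := (KantorP Kb, KantorP Kc).
  by rewrite Kantor_starE groupM ?groupV //= permM Ebc permK.
have sub : [set b (foot i) | b : {perm P} in Kantor j] \subset L :\ x.
  apply/subsetP=> _ /imsetP[b Kb ->]; have [Hb _] := KantorP Kb.
  apply/setD1P; split; last by rewrite -(H_line Hb LL Lx) imset_f.
  by rewrite -(H_fix_x Hb) (inj_eq perm_inj) foot_neq_x.
have cardL : #|L :\ x| = q.
  by have := cardsD1 x L; rewrite Lx (card_line GQ LL) => -[].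
have /eqP Eim : [set b (foot i) | b : {perm P} in Kantor j] == L :\ x.
  by rewrite eqEcard sub cardL card_in_imset ?card_Kantor /=.
have : v \in L :\ x by rewrite !inE neq_vx.
by rewrite -Eim => /imsetP[b Kb ->]; exists b.
Qed.

Lemma mulg_star_Kantor i j : i != j -> Kantor_star i * Kantor j = H.
Proof.
move=> neq_ij; apply/eqP; rewrite eqEsubset mul_subG ?subsetIl //=.
apply/subsetP=> h Hh; have [L [LL Lx Lu _]] := foot_line i.
have Lhu : h (foot i) \in L by rewrite -(H_line Hh LL Lx) imset_f.
have neq_hx : h (foot i) != x.
  by rewrite -(H_fix_x Hh) (inj_eq perm_inj) foot_neq_x.
have [b Kb bu] := Kantor_transitive_line neq_ij LL Lx Lu Lhu neq_hx.
rewrite -(mulgKV b h) mem_mulg // Kantor_starE; have [Hb _] := KantorP Kb.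
by rewrite groupM ?groupV //= permM -bu permK.
Qed.

(** A conjugate of an element of [S] still fixes every [foot k], so it lies in every
    [Kantor_star k], and two of these meet in [S]. *)
Lemma norm_S : H \subset 'N(S).
Proof.
apply/subsetP=> h Hh; rewrite inE; apply/subsetP=> _ /imsetP[s Ss ->].
have /card_gt0P[i _] : 0 < #|pencil| by rewrite card_pencil.
have [j neq_ji] := exists_other_pencil i.
have star_sh k : s ^ h \in Kantor_star k.
  rewrite Kantor_starE groupJ ?(subsetP sSH s) //= conjgE !permM.
  have [_ xu] := footP k.
  by rewrite (S_fix Ss) ?permKV // H_collx ?groupV.
have := star_sh i; rewrite -mulg_Kantor_S => /mulsgP[a t Ka St Esh].
suff a1 : a = 1 by rewrite Esh a1 mul1g.
apply/set1P; rewrite -[[set 1]](TI_Kantor_star neq_ji) inE Ka andbT.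
by rewrite -(groupMr a (subsetP (S_sub_star j) t St)) -Esh.
Qed.

(** * Condition (M)_x and centrality of [S] *)

Variables p n : nat.
Hypotheses (p_pr : prime p) (p_odd : odd p) (n_gt0 : 0 < n) (defq : q = (p ^ n)%N).

(** [Kantor_star i] is normal in [H], so it fixes all images of [foot i] under [H]; these include
    every point of [L] other than [x]. *)
Lemma star_fix_line i L a v :
    L \in Lines -> x \in L -> foot i \in L -> v \in L ->
  a \in Kantor_star i -> a v = v.
Proof.
move=> LL Lx Lu Lv Ka.
have Ha : a \in H by move: Ka; rewrite Kantor_starE => /andP[].
have [->|neq_vx] := eqVneq v x; first exact: H_fix_x.
have [j neq_ji] := exists_other_pencil i; rewrite eq_sym in neq_ji.
have [b Kb <-] := Kantor_transitive_line neq_ji LL Lx Lu Lv neq_vx.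
have [Hb _] := KantorP Kb.
have := normal_norm (normal_As p_pr p_odd n_gt0 defq card_pencil card_Kantor cardS
  sSH norm_S mulg_Kantor_S (@mulg_star_Kantor) (@TI_Kantor_star) i).
move/subsetP/(_ _ (groupVr Hb)) => nKb; move: Ka; rewrite -(memJ_norm a nKb).
rewrite Kantor_starE conjgE invgK !permM => /andP[_ /eqP].
by move/(congr1 b); rewrite permKV.
Qed.

Lemma central_of_condM : condM Lines x -> S \subset 'Z(H).
Proof.
move=> Mx; apply: (central_of_normalised p_pr p_odd n_gt0 defq card_pencil
  card_Kantor cardS sSH norm_S mulg_Kantor_S (@mulg_star_Kantor)
  (@TI_Kantor_star) (@TI_Kantor)) => i.
have [iu xu] := footP i; have [L [LL Lx Lu nLz]] := foot_line i.
have fix_l a l : a \in Kantor i -> l \in Lines -> foot i \in l -> a @: l = l.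
  move=> Ka Ll lu; have [Ha ai] := KantorP Ka.
  have neq_iL : val i != L by apply: contraNneq nLz => <-; apply: pencil_z.
  have iaz : a z \in val i by rewrite -ai imset_f ?pencil_z.
  have nxaz : ~~ coll x (a z) by rewrite H_collx ?base_opp.
  (* Condition (M)_x yields [g] with [g z = a z]. Then [g * a^-1] fixes [z] and, by rigidity, all
     lines on [foot i]; as [g] fixes these lines, so does [a]. *)
  have [g] := Mx L (foot i) (val i) LL Lx Lu (foot_neq_x i) (pencil_line i) iu neq_iL
    z (a z) (pencil_z i) (foot_neq i base_opp) iaz (foot_neq i nxaz).
  rewrite inE => /andP[Autg /andP[/andP[/forall_inP gx /forall_inP gu] gL]] gz.
  move/forall_inP: gL => gL.
  have Ka' := subsetP (sub_Kantor_star i) _ (groupVr Ka).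
  have agl : (g * a^-1) @: l = l.
    apply: (@fix_pencil _ _ _ q_gt1 GQ x L (g * a^-1) _ LL Lx _ _ z (foot i)) => //.
    - exact: AutM Autg (H_Aut (groupVr Ha)).
    - move=> l' Ll' l'x; rewrite imset_permM (eqP (implyP (gx l' Ll') l'x)).
      by rewrite H_line ?groupV.
    - move=> v Lv; rewrite permM (eqP (gL v Lv)).
      exact: star_fix_line LL Lx Lu Lv Ka'.
    - exact: base_opp.
    - by rewrite permM gz permK.
    exact: line_coll (pencil_line i) (pencil_z i) iu.
  have a'l : a^-1 @: l = l.
    by rewrite -{2}agl imset_permM (eqP (implyP (gu l Ll) lu)).
  by rewrite -{1}a'l -{1}[a]invgK imset_permK.
(* [s^-1] sends [val i] to a line on [foot i], which [a] fixes; hence [a ^ s] fixes [val i]. *)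
apply/subsetP=> s Ss; rewrite inE; apply/subsetP=> _ /imsetP[a Ka ->].
have Hs := subsetP sSH s Ss; have [Ha _] := KantorP Ka.
rewrite KantorE groupJ //= conjgE !imset_permM.
have [Ls lu] := star_line_image (subsetP (S_sub_star i) _ (groupVr Ss)).
by rewrite (fix_l a _ Ka Ls lu) -{1}[s]invgK imset_permK.
Qed.

(** The lines on [foot i] other than [L] are images of [val i] under [S], so an element of
    [Kantor i], commuting with [S], fixes them all. *)
Lemma central_Kantor_fix i L :
    S \subset 'Z(H) -> L \in Lines -> x \in L -> foot i \in L ->
  forall w, w \in val i -> w != foot i ->
  exists2 g, g \in [set g in Defs.Aut Lines |
    [forall l in Lines, (x \in l) ==> (g @: l == l)] &&
    [forall l in Lines, (foot i \in l) ==> (g @: l == l)] &&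
    [forall v in L, g v == v]] & g z = w.
Proof.
move=> sSZ LL Lx Lu w iw neq_w.
have [g Kg gz] := Kantor_transitive iw neq_w; have [Hg gi] := KantorP Kg.
exists g => //; rewrite inE H_Aut //=; apply/andP; split; first (apply/andP; split).
- by apply/forall_inP=> l Ll; apply/implyP=> lx; rewrite H_line.
- apply/forall_inP=> l Ll; apply/implyP=> lu.
  have [->|neq_lL] := eqVneq l L; first by rewrite H_line.
  have [s Ss <-] := S_transitive LL Lx Lu Ll lu neq_lL.
  have /centerP[_ /(_ g Hg) csg] := subsetP sSZ s Ss.
  by rewrite -imset_permM csg imset_permM gi.
apply/forall_inP=> v Lv; apply/eqP.
exact: star_fix_line LL Lx Lu Lv (subsetP (sub_Kantor_star i) g Kg).
Qed.

Lemma abelian_star_iff :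
  (forall U u, U \in Lines -> z \in U -> u \in U -> coll u x ->
     abelian 'C_H[u | 'P]) <-> S \subset 'Z(H).
Proof.
rewrite -(abelian_As_iff_central p_pr p_odd n_gt0 defq card_pencil card_Kantor cardS
  sSH norm_S mulg_Kantor_S (@mulg_star_Kantor) (@TI_Kantor_star)).
split=> [abC i|abC U u LU Uz Uu ux].
  have [iu xu] := footP i.
  by apply: (abC (val i)); rewrite ?pencil_line ?pencil_z // collC.
have Ui : (U \in Lines) && (z \in U) by rewrite LU.
by rewrite (@foot_uniq (Sub U Ui) u) ?SubK //; [apply: abC | rewrite collC].
Qed.

End ElationQuadrangle.

Theorem mainTheorem11 (P : finType) (Lines : {set {set P}}) (p n q : nat)
  (x : P) (H S : {group {perm P}}) (z : P) :
  prime p -> odd p -> 0 < n -> q = (p ^ n)%N ->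
  is_GQ Lines q q ->
  is_EGQ Lines x H ->
  (* S: subgroup of H of order t = q consisting of symmetries about x *)
  S \subset H -> #|S| = q -> (forall g, g \in S -> is_symmetry Lines x g) ->
  (* base point z of the Kantor family *)
  z \in opp_pts Lines x ->
  [/\ (* (i) <-> (ii) *)
      ((forall U u, U \in Lines -> z \in U -> u \in U -> collinear Lines u x ->
          abelian 'C_H[u | 'P]) <-> condM Lines x),
      (* (ii) <-> (iii) *)
      (condM Lines x <-> special_pgroup p H /\ exponent H = p),
      (* (iii) <-> (iv) *)
      (special_pgroup p H /\ exponent H = p <-> S \subset 'Z(H)) &
      (* (iv) <-> (v) *)
      (S \subset 'Z(H) <-> (S :=: 'Z(H)))].
Proof.
move=> p_pr p_odd n_gt0 defq GQ EGQ sSH cardS symS opp_z.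
have q_gt1 : 1 < q := ltnW (q_gt2 p_pr p_odd n_gt0 defq).
have cM : condM Lines x <-> S \subset 'Z(H).
  split=> [|sSZ L y M LL Lx Ly neq_yx LM My neq_ML /= a b Ma neq_ay Mb neq_by].
    exact: (central_of_condM q_gt1 GQ EGQ sSH cardS symS opp_z p_pr p_odd n_gt0 defq).
  have nMx : x \notin M.
    apply: contra neq_ML => Mx; apply/eqP.
    exact: (line_eq GQ neq_yx LM LL My Mx Ly Lx).
  have xy : collinear Lines x y := line_coll LL Lx Ly.
  have opp_a : a \in opp_pts Lines x.
    rewrite inE; apply: contra neq_ay => xa.
    by rewrite (no_triangle GQ LM nMx Ma My xa xy).
  have Mi : (M \in Lines) && (a \in M) by rewrite LM.
  (* Centrality of [S] does not mention the base point, which is therefore moved to [a]: [M] becomes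
     a line of the pencil at [a], with [y] as its foot. *)
  pose i : pencil Lines a := Sub M Mi.
  have Ey : y = foot x i by apply: (foot_uniq GQ opp_a).
  rewrite {}Ey in Ly neq_by *.
  exact: (central_Kantor_fix q_gt1 GQ EGQ sSH cardS symS opp_a p_pr p_odd n_gt0 defq).
have nSH := norm_S q_gt1 GQ EGQ sSH cardS symS opp_z.
have cardI := card_pencil z GQ.
have cardK := card_Kantor q_gt1 GQ EGQ opp_z.
have defKs := mulg_Kantor_S q_gt1 GQ EGQ sSH cardS symS opp_z.
have defH := @mulg_star_Kantor _ _ _ _ _ _ q_gt1 GQ EGQ opp_z.
have tiKs := @TI_Kantor_star _ _ _ _ _ _ GQ EGQ opp_z.
have tiK := @TI_Kantor _ _ _ _ _ _ q_gt1 GQ EGQ opp_z.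
have sp := special_iff_central p_pr p_odd n_gt0 defq cardI cardK cardS sSH nSH
  defKs defH tiKs tiK.
have ab := abelian_star_iff q_gt1 GQ EGQ sSH cardS symS opp_z p_pr p_odd n_gt0 defq.
split=> //; first by rewrite ab cM.
  by rewrite sp cM.
split=> [|-> //].
exact: (center_H p_pr p_odd n_gt0 defq cardI cardK cardS sSH nSH defKs defH tiKs tiK).
Qed.
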